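(* For every integer $n\ge0$ and every $x$, the Hermite polynomials are obtained from the Jacobi polynomials by $$\frac{1}{n!}H_n(x)=\lim_{\alpha\to\infty}\left(\frac{2}{\sqrt{\alpha}}\right)^nJ_n^{(\alpha,\alpha)}\left(\frac{x}{\sqrt{\alpha}}\right).$$
   Context: $J_n^{(\alpha,\beta)}(x)=\sum_{k=0}^n\binom{n+\alpha}{n-k}\binom{n+\beta}{k}\left(\frac{x-1}{2}\right)^k\left(\frac{x+1}{2}\right)^{n-k}$ are the Jacobi polynomials and $H_n(x)=(-1)^ne^{x^2}\frac{d^n}{dx^n}e^{-x^2}$ the Hermite polynomials (orthogonal with weight $e^{-x^2}$). The limit is through real $\alpha\to+\infty$. *)

(* Defs.v *)
From HB Require Import structures.
From mathcomp Require Import all_boot all_order all_algebra.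
From mathcomp Require Import all_classical all_reals all_analysis.

Set Implicit Arguments.
Unset Strict Implicit.
Unset Printing Implicit Defensive.

Import Order.TTheory GRing.Theory Num.Theory.
Import numFieldNormedType.Exports.

Local Open Scope classical_set_scope.
Local Open Scope ring_scope.

(* Binomial coefficient with a real upper argument:
   a (a - 1) ... (a - k + 1) / k!. *)
Definition gbinom (R : realType) (a : R) (k : nat) : R :=
  (\prod_(i < k) (a - i%:R)) / k`!%:R.

Definition jacobi (R : realType) (n : nat) (alpha beta : R) (x : R) : R :=
  \sum_(k < n.+1)
    gbinom (n%:R + alpha) (n - k) * gbinom (n%:R + beta) k
    * ((x - 1) / 2) ^+ k * ((x + 1) / 2) ^+ (n - k).

(* Physicists' normalization, by the Rodrigues formula; [derive1n n] is the
   [n]-th derivative. *)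
Definition hermite (R : realType) (n : nat) (x : R) : R :=
  (-1) ^+ n * expR (x ^+ 2) * derive1n n (fun t : R => expR (- t ^+ 2)) x.

(* Main.v *)
Require Import Defs.
From HB Require Import structures.
From mathcomp Require Import all_boot all_order all_algebra.
From mathcomp Require Import all_classical all_reals all_analysis.
From mathcomp Require Import ring.

Set Implicit Arguments.
Unset Strict Implicit.
Unset Printing Implicit Defensive.

Import Order.TTheory GRing.Theory Num.Theory.
Import numFieldNormedType.Exports.

Local Open Scope classical_set_scope.
Local Open Scope ring_scope.

(* With y = x / sqrt alpha and N = n + alpha, the rescaled Jacobi value is the
   coefficient of z^n in
     (1 + (y - 1) z / sqrt alpha)^N (1 + (y + 1) z / sqrt alpha)^N
       = (1 + (2 x z - z^2) / alpha + x^2 z^2 / alpha^2)^N,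
   which tends to exp (2 x z - z^2), the generating function of H_n(x) / n!.
   The convergence is obtained coefficientwise: for fixed N, the first-order
   linear ODE of the left-hand side gives a three-term recurrence in the index
   of the coefficient, whose limit as alpha -> +oo is the recurrence
   (k+2) h_(k+2) = 2 x h_(k+1) - 2 h_k of h_k = H_k(x) / k!. *)

(** Truncation of (1 + a z)^N, an infinite series for general real N, so that the ODE argument can
    use formal derivatives of polynomials. *)
Definition binomial_poly (R : realType) (N a : R) (M : nat) : {poly R} :=
  \poly_(i < M) (gbinom N i * a ^+ i).

(* The coefficient of z^k in the power series (1 + p z)^N (1 + q z)^N. *)
Definition binomial_conv (R : realType) (N p q : R) (k : nat) : R :=
  \sum_(i < k.+1) gbinom N (k - i) * gbinom N i * p ^+ i * q ^+ (k - i).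

Lemma gbinomS (R : realType) (N : R) (k : nat) :
  gbinom N k.+1 * k.+1%:R = (N - k%:R) * gbinom N k.
Proof.
rewrite /gbinom big_ord_recr /= factS natrM.
have h1 : k.+1%:R != 0 :> R by rewrite pnatr_eq0.
have h2 : k`!%:R != 0 :> R by rewrite pnatr_eq0 -lt0n fact_gt0.
move: (k.+1%:R) (k`!%:R) (k%:R) h1 h2 => a b c h1 h2.
by field; rewrite h1 h2.
Qed.

Lemma binomial_convE (R : realType) (N p q : R) (M k : nat) : (k < M)%N ->
  (binomial_poly N p M * binomial_poly N q M)`_k = binomial_conv N p q k.
Proof.
move=> kM; rewrite coefM; apply: eq_bigr => -[i /= ik] _.
rewrite !coef_poly (leq_ltn_trans _ kM) ?(leq_ltn_trans _ kM) ?leq_subr //.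
by ring.
Qed.

(* (1 + a z) F' = N a F for F = (1 + a z)^N; the truncation at M only affects
   the coefficients of index at least M - 1. *)
Lemma binomial_poly_ode (R : realType) (N a : R) (M k : nat) : (k.+1 < M)%N ->
  ((1 + a%:P * 'X) * (binomial_poly N a M)^`()
    - (N * a)%:P * binomial_poly N a M)`_k = 0.
Proof.
move=> kM.
have AE i : (i < M)%N -> (binomial_poly N a M)`_i = gbinom N i * a ^+ i.
  by move=> iM; rewrite coef_poly iM.
rewrite mulrDl mul1r -mulrA coefB coefD !coefCM coefXM coef_deriv.
rewrite !AE ?(ltnW kM) // -mulr_natr mulrAC gbinomS.
case: k kM => [|k] kM /=; first by ring.
by rewrite coef_deriv AE ?(ltnW kM) // -mulr_natr !exprS; ring.
Qed.

Lemma coefM_eq0 (R : nzRingType) (p q : {poly R}) (k : nat) :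
  (forall i, (i <= k)%N -> p`_i = 0) -> (p * q)`_k = 0.
Proof.
by move=> p0; rewrite coefM big1 // => i _; rewrite p0 ?mul0r // -ltnS.
Qed.

(** Product rule: (1 + p z)(1 + q z) W' = N (p (1 + q z) + q (1 + p z)) W. The defect is a
    combination of the defects [E] of the two factors, which vanish up to index k. *)
Lemma binomial_conv_ode (R : realType) (N p q : R) (M k : nat) (W : {poly R}) :
    W = binomial_poly N p M * binomial_poly N q M -> (k.+1 < M)%N ->
  (W^`() + (p + q)%:P * (W^`() * 'X) + (p * q)%:P * (W^`() * 'X * 'X))`_k =
  ((N * (p + q))%:P * W + (2 * N * p * q)%:P * (W * 'X))`_k.
Proof.
move=> -> kM; set A := binomial_poly N p M; set B := binomial_poly N q M.
set E := fun (a : R) (P : {poly R}) =>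
  (1 + a%:P * 'X) * P^`() - (N * a)%:P * P.
have E0 a P i : P = binomial_poly N a M -> (i <= k)%N -> (E a P)`_i = 0.
  move=> -> ik; apply: binomial_poly_ode; exact: leq_ltn_trans kM.
set L := _ + _ * (_ * 'X * 'X); set P := _ + _ * (A * B * 'X).
suff H : L - P = E p A * ((1 + q%:P * 'X) * B) + E q B * ((1 + p%:P * 'X) * A).
  apply/eqP; rewrite -subr_eq0 -coefB H coefD.
  by rewrite !coefM_eq0 ?addr0 // => i; apply: E0.
by rewrite /L /P /E derivM !polyCM polyCD; ring.
Qed.

Lemma binomial_conv0 (R : realType) (N p q : R) : binomial_conv N p q 0 = 1.
Proof.
by rewrite /binomial_conv big_ord1 /gbinom !big_ord0 fact0 !expr0; field.
Qed.

Lemma binomial_conv1 (R : realType) (N p q : R) :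
  binomial_conv N p q 1 = N * (p + q).
Proof.
rewrite /binomial_conv !big_ord_recr big_ord0 /gbinom /= !big_ord0.
by rewrite !big_ord1 /= subn0 subnn (factS 0) fact0 muln1 !(expr0, expr1); field.
Qed.

Lemma binomial_convSS (R : realType) (N p q : R) (k : nat) :
  k.+2%:R * binomial_conv N p q k.+2 =
  (N - k.+1%:R) * (p + q) * binomial_conv N p q k.+1
  + (2 * N - k%:R) * (p * q) * binomial_conv N p q k.
Proof.
(* Coefficient of z^(k+1) in the ODE; truncating at k + 3 keeps the indices up to k + 2 that
   occur. *)
have := binomial_conv_ode (N := N) (p := p) (q := q) erefl (ltnSn k.+2).
have := @binomial_convE R N p q k.+3.
move: (_ * _) => W WE.
rewrite !(coefD, coefCM, coefMX, coef_deriv) /=.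
have -> : (if k == 0%N then 0 else W`_k.-1.+1 *+ k.-1.+1) = k%:R * W`_k.
  by case: (k) => [|m]; rewrite ?mul0r // mulr_natl.
rewrite !{}WE ?ltnS ?leqW // => H.
apply/eqP; rewrite -subr_eq0; apply/eqP.
move: H => /eqP; rewrite -subr_eq0 => /eqP H; rewrite -[RHS]H.
by ring.
Qed.

(** This is the recursion obtained by differentiating (-1)^n H_n(t) exp (- t^2) once more. *)
Fixpoint hermite_poly (R : realType) (n : nat) : {poly R} :=
  if n is m.+1 then 'X *+ 2 * hermite_poly R m - (hermite_poly R m)^`() else 1.

(** Differentiating the recursion and applying the induction hypothesis to H' and H'' leaves 2
    H_(n+1) + 2 (n+1) (2 x H_n - H_n'). This turns the recursion into a three-term one. *)
Lemma deriv_hermite_poly (R : realType) (n : nat) :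
  (hermite_poly R n.+1)^`() = hermite_poly R n *+ n.+1.*2.
Proof.
elim: n => [|n IHn]; first by rewrite /= !poly.derivE -mul2n; ring.
rewrite [hermite_poly R n.+2]/= -/(hermite_poly R n.+1) derivB derivM.
rewrite derivMn derivX IHn derivMn -mul2n -[n.+2.*2]mul2n.
have -> : hermite_poly R n.+1 =
  'X *+ 2 * hermite_poly R n - (hermite_poly R n)^`() by [].
by ring.
Qed.

Lemma hermite_polySS (R : realType) (n : nat) (x : R) :
  (hermite_poly R n.+2).[x] =
  2 * x * (hermite_poly R n.+1).[x] - 2 * n.+1%:R * (hermite_poly R n).[x].
Proof.
have -> : hermite_poly R n.+2 =
   'X *+ 2 * hermite_poly R n.+1 - (hermite_poly R n.+1)^`() by [].
rewrite deriv_hermite_poly hornerD hornerN hornerM !hornerMn hornerX.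
by rewrite -mul2n; ring.
Qed.

Lemma derive1n_gauss (R : realType) (n : nat) :
  derive1n n (fun t : R => expR (- t ^+ 2)) =
  (fun t => (-1) ^+ n * (hermite_poly R n).[t] * expR (- t ^+ 2)).
Proof.
elim: n => [|n IHn].
  by rewrite derive1n0; apply/funext => t; rewrite expr0 hornerC !mul1r.
rewrite derive1nS IHn; apply/funext => t; rewrite derive1E.
have Dg : is_derive t 1 (fun u : R => expR (- u ^+ 2)) (- (2 * t) * expR (- t ^+ 2)).
  have D1 : is_derive t 1 (fun u : R => - u ^+ 2) (- (2 * t)).
    by apply: is_derive_eq; rewrite /GRing.scale /=; ring.
  by apply: is_derive_eq; rewrite /GRing.scale /=; ring.
have Dp : is_derive t 1 (horner (hermite_poly R n)) (hermite_poly R n)^`().[t].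
  by rewrite derivE derive1E; apply/derivableP/derivable_horner.
have D : is_derive t 1 (fun u => (-1) ^+ n * (hermite_poly R n).[u] * expR (- u ^+ 2))
   ((-1) ^+ n.+1 * (hermite_poly R n.+1).[t] * expR (- t ^+ 2)).
  apply: is_derive_eq; rewrite /GRing.scale /= hornerD hornerN hornerM.
  by rewrite hornerMn hornerX [_ ^+ n.+1]exprS; ring.
by rewrite derive_val.
Qed.

Lemma hermiteE (R : realType) (n : nat) (x : R) :
  hermite n x = (hermite_poly R n).[x].
Proof.
rewrite /hermite derive1n_gauss mulrACA [_ * (_ * _.[x])]mulrA -exprMn mulrN1.
by rewrite opprK expr1n mul1r -expRD subrr expR0 mulr1.
Qed.

Lemma jacobiE (R : realType) (n : nat) (alpha x : R) :
  (2 / Num.sqrt alpha) ^+ n * jacobi n alpha alpha (x / Num.sqrt alpha) =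
  (Num.sqrt alpha)^-1 ^+ n *
  binomial_conv (n%:R + alpha) (x / Num.sqrt alpha - 1)
    (x / Num.sqrt alpha + 1) n.
Proof.
rewrite exprMn mulrAC mulrC; congr (_ * _).
rewrite /jacobi /binomial_conv mulr_sumr; apply: eq_bigr => -[i /= ik] _.
(* The factor 2^n splits as 2^i 2^(n-i) and cancels the halves in the i-th Jacobi term. *)
have two m : (2 : R) ^+ m * 2^-1 ^+ m = 1.
  by rewrite -exprMn divff ?expr1n // pnatr_eq0.
have -> : (2 : R) ^+ n = 2 ^+ i * 2 ^+ (n - i) by rewrite -exprD subnKC.
rewrite !exprMn.
move: (x / _) => y.
rewrite -[RHS]mulr1 -[X in _ = _ * X](two i).
rewrite -[RHS]mulr1 -[X in _ = _ * X](two (n - i)%N).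
by ring.
Qed.

Lemma cvg_affine_div (R : realType) (a b : R) :
  (a * alpha + b) / alpha @[alpha --> +oo] --> a.
Proof.
have inv0 : (@GRing.inv R) @ +oo --> (0 : R).
  apply/cvgrVy; first by near=> t; rewrite invr_gt0; near: t; exact: nbhs_pinfty_gt.
  rewrite [X in X @ _](_ : _ = id); first exact: cvg_id.
  by apply/funext => t; rewrite /= invrK.
have C : a + b * alpha^-1 @[alpha --> +oo] --> a + b * 0.
  by apply: cvgD; [exact: cvg_cst|apply: cvgM => //; exact: cvg_cst].
move: C; rewrite mulr0 addr0; apply: cvg_trans.
apply: near_eq_cvg; near=> t => /=.
by have t0 : t != 0; [apply: lt0r_neq0; near: t; exact: nbhs_pinfty_gt|field].
Unshelve. all: by end_near.
Qed.

(** The shift [c] is decoupled from [k], since the recurrence moves the index while N = c + alpha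
    stays the same. *)
Lemma cvg_scaled_binomial_conv (R : realType) (c x : R) (k : nat) :
  (fun alpha : R => (Num.sqrt alpha)^-1 ^+ k *
     binomial_conv (c + alpha) (x / Num.sqrt alpha - 1)
       (x / Num.sqrt alpha + 1) k) @ +oo
  --> (k`!%:R)^-1 * hermite k x.
Proof.
pose e j alpha : R := (Num.sqrt alpha)^-1 ^+ j *
  binomial_conv (c + alpha) (x / Num.sqrt alpha - 1) (x / Num.sqrt alpha + 1) j.
rewrite hermiteE -/(e k).
(* Two consecutive limits are carried along, as the recurrence has order two. *)
suff : e k @ +oo --> (k`!%:R)^-1 * (hermite_poly R k).[x] /\
       e k.+1 @ +oo --> (k.+1`!%:R)^-1 * (hermite_poly R k.+1).[x] by case.
elim: k => [|k [IH0 IH1]]; split=> //.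
- rewrite [e 0](_ : _ = cst 1); last first.
    by apply/funext => t; rewrite /e binomial_conv0 expr0 mulr1.
  by rewrite fact0 hornerC invr1 mulr1; exact: cvg_cst.
- have -> : (1`!%:R)^-1 * (hermite_poly R 1).[x] = 1 * (2 * x) :> R.
    by rewrite /= poly.derivE !hornerE (factS 0) fact0 muln1; field.
  have C : (1 * alpha + c) / alpha * (2 * x) @[alpha --> +oo] --> 1 * (2 * x).
    by apply: cvgM; [exact: cvg_affine_div|exact: cvg_cst].
  apply: cvg_trans C.
  (* The identity holds only eventually: the square root is 0 for alpha <= 0. *)
  apply: near_eq_cvg; near=> t => /=.
  have t0 : 0 < t by near: t; exact: nbhs_pinfty_gt.
  have s0 : Num.sqrt t != 0 by rewrite gt_eqF // sqrtr_gt0.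
  rewrite /e binomial_conv1 -[in LHS](sqr_sqrtr (ltW t0)).
  rewrite -[in RHS](sqr_sqrtr (ltW t0)) sqrtr_sqr ger0_norm ?sqrtr_ge0 //.
  by field.
(* The constants 1, 2 and 0 are kept as limits of the affine quotients in [C1] and [C2], which come
   from p + q = 2 x / sqrt alpha and p q = x^2 / alpha - 1. *)
have -> : (k.+2`!%:R)^-1 * (hermite_poly R k.+2).[x] =
    (1 * (2 * x) * ((k.+1`!%:R)^-1 * (hermite_poly R k.+1).[x])
     + 2 * (0 * x ^+ 2 - 1) * ((k`!%:R)^-1 * (hermite_poly R k).[x])) / k.+2%:R.
  rewrite hermite_polySS !factS !natrM.
  have h0 : k`!%:R != 0 :> R by rewrite pnatr_eq0 -lt0n fact_gt0.
  have h1 : k.+1%:R != 0 :> R by rewrite pnatr_eq0.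
  have h2 : k.+2%:R != 0 :> R by rewrite pnatr_eq0.
  move: (k`!%:R) (k.+1%:R) (k.+2%:R) h0 h1 h2 => a b d h0 h1 h2.
  by field; rewrite h0 h1 h2.
have C1 : (1 * alpha + (c - k.+1%:R)) / alpha * (2 * x) * e k.+1 alpha
    @[alpha --> +oo] --> 1 * (2 * x) * ((k.+1`!%:R)^-1 * (hermite_poly R k.+1).[x]).
  by apply: cvgM => //; apply: cvgM; [exact: cvg_affine_div|exact: cvg_cst].
have C2 : (2 * alpha + (2 * c - k%:R)) / alpha
      * ((0 * alpha + 1) / alpha * x ^+ 2 - 1) * e k alpha
    @[alpha --> +oo] --> 2 * (0 * x ^+ 2 - 1) * ((k`!%:R)^-1 * (hermite_poly R k).[x]).
  apply: cvgM => //; apply: cvgM; first exact: cvg_affine_div.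
  by apply: cvgB; [apply: cvgM; [exact: cvg_affine_div|]|]; exact: cvg_cst.
apply: cvg_trans (cvgM (cvgD C1 C2) (cvg_cst (k.+2%:R^-1 : R))).
apply: near_eq_cvg; near=> t => /=.
have t0 : 0 < t by near: t; exact: nbhs_pinfty_gt.
have s0 : Num.sqrt t != 0 by rewrite gt_eqF // sqrtr_gt0.
have k0 : k.+2%:R != 0 :> R by rewrite pnatr_eq0.
apply: (mulfI k0); rewrite mulrCA mulfV // mulr1 /e mulrCA binomial_convSS.
rewrite fctE ![_ ^+ _.+2]exprS ![_ ^+ k.+1]exprS.
move: (binomial_conv _ _ _ k.+1) (binomial_conv _ _ _ k) => u v.
(* Replacing alpha by s^2 makes both sides rational in s. *)
move: (Num.sqrt t) s0 (sqr_sqrtr (ltW t0)) => s s0 <-.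
move: (_ ^+ k) => w.
by field.
Unshelve. all: by end_near.
Qed.

Theorem mainTheorem14 (R : realType) (n : nat) (x : R) :
  (fun alpha : R =>
     (2 / Num.sqrt alpha) ^+ n * jacobi n alpha alpha (x / Num.sqrt alpha))
    @ +oo --> (n`!%:R)^-1 * hermite n x.
Proof.
under eq_fun do rewrite jacobiE.
exact: cvg_scaled_binomial_conv.
Qed.
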